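(* Given a temporal Heyting algebra $A$, the following are equivalent: (1) $A$ is subdirectly-irreducible; (2) the poset of $\mathsf{P}$-filters of $A$ (under inclusion) has a second-least element; (3) the set of topo-roots of $\mathrm{Spec}(A)$ is non-empty and open.
   Context: Write $\mathsf{P}$ for the ''past diamond'' operator (black diamond). A temporal Heyting algebra is a Heyting algebra with operators $\Box,\mathsf{P}$ such that $\Box(a\wedge b)=\Box a\wedge\Box b$, $a\le\Box a$, $\Box a\le b\vee(b\to a)$, and $\mathsf{P}a\le b\iff a\le\Box b$. A $\mathsf{P}$-filter is a filter $F$ such that $a\to b\in F$ implies $\mathsf{P}a\to\mathsf{P}b\in F$. $\mathrm{Spec}(A)$ is the space of prime filters ordered by inclusion, with topology generated by $\pi a=\{x:a\in x\}$ and complements, $xR^{\rhd}y$ iff $\forall a(\Box a\in x\Rightarrow a\in y)$, $xR^{\lhd}w$ iff $\forall a(a\in w\Rightarrow\mathsf{P}a\in x)$. A subset $S$ is archival if $x\notin S$, $z\in S$, $zR^{\lhd}x$ imply $R^{\lhd}[z]\cap{\uparrow}x\cap S\ne\varnothing$. $y$ is topo-reachable from $x$ if $y$ lies in every closed archival upset containing $x$; $x$ is a topo-root if every point is topo-reachable from $x$. *)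

(* Defs.v *)
From HB Require Import structures.
From mathcomp Require Import all_boot all_order.
From mathcomp Require Import all_classical.
From mathcomp Require Import topology.

Set Implicit Arguments.
Unset Strict Implicit.
Unset Printing Implicit Defensive.

Import Order.TTheory.
Local Open Scope classical_set_scope.

HB.mixin Record TBLattice_isHeyting d T of Order.TBLattice d T := {
  himp : T -> T -> T;
  lehimp : forall a b c : T, (c <= himp a b)%O = (c `&` a <= b)%O
}.

#[short(type="heytingType")]
HB.structure Definition Heyting d :=
  { T of TBLattice_isHeyting d T & Order.TBLattice d T }.

(* [box] is the white box, [past] the black diamond (its left adjoint). *)
HB.mixin Record Heyting_isTemporal d T of Heyting d T := {
  box : T -> T;
  past : T -> T;
  boxI : forall a b : T, box (a `&` b)%O = (box a `&` box b)%O;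
  le_box : forall a : T, (a <= box a)%O;
  box_le : forall a b : T, (box a <= b `|` himp b a)%O;
  past_le : forall a b : T, (past a <= b)%O = (a <= box b)%O
}.

#[short(type="temporalHeytingType")]
HB.structure Definition TemporalHeyting d :=
  { T of Heyting_isTemporal d T & Heyting d T }.

Record temporal_morphism d (A B : temporalHeytingType d) (f : A -> B) : Prop := {
  tmorph0 : f \bot%O = \bot%O;
  tmorph1 : f \top%O = \top%O;
  tmorphI : {morph f : a b / (a `&` b)%O};
  tmorphU : {morph f : a b / (a `|` b)%O};
  tmorph_imp : {morph f : a b / himp a b};
  tmorph_box : {morph f : a / box a};
  tmorph_past : {morph f : a / past a}
}.

(* An embedding of A into the product of the B i with surjective projections;
   the operations of the product being pointwise, f is a morphism iff each of
   its components is. *)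
Definition subdirect_embedding d (A : temporalHeytingType d) (I : Type)
    (B : I -> temporalHeytingType d) (f : A -> forall i, B i) : Prop :=
  injective f /\
  forall i, temporal_morphism (fun a => f a i) /\
            forall b : B i, exists a, f a i = b.

(* The index type I may be empty, hence the one-element algebra, which embeds
   in the empty product, is not subdirectly irreducible. The B i share the
   display d of A, which is only a printing tag. *)
Definition subdirectly_irreducible d (A : temporalHeytingType d) : Prop :=
  forall (I : Type) (B : I -> temporalHeytingType d) (f : A -> forall i, B i),
    subdirect_embedding f -> exists i, bijective (fun a => f a i).

Section Filters.
Context d (A : temporalHeytingType d).
Implicit Types F : set A.

(* Not assumed proper: the whole algebra is a filter. *)
Definition lattice_filter F : Prop :=
  [/\ F !=set0,
      (forall a b, F a -> (a <= b)%O -> F b) &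
      (forall a b, F a -> F b -> F (a `&` b)%O)].

Definition prime_filter F : Prop :=
  [/\ lattice_filter F, F <> setT & forall a b, F (a `|` b)%O -> F a \/ F b].

Definition past_filter F : Prop :=
  lattice_filter F /\
  forall a b, F (himp a b) -> F (himp (past a) (past b)).

End Filters.

Section SecondLeast.
Context (T : Type).
Implicit Types (C : set (set T)) (m s : set T).

Definition is_least C m : Prop := C m /\ forall F, C F -> m `<=` F.

Definition is_second_least C s : Prop :=
  exists2 m, is_least C m & is_least (C `\ m) s.

End SecondLeast.

Definition Spec d (A : temporalHeytingType d) : Type :=
  set_type [set x : set A | prime_filter x].

HB.instance Definition _ d (A : temporalHeytingType d) :=
  Choice.copy (Spec A) (set_type [set x : set A | prime_filter x]).

Definition pset d (A : temporalHeytingType d) (x : Spec A) : set A := val x.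

Definition spec_pi d (A : temporalHeytingType d) (a : A) : set (Spec A) :=
  [set x | pset x a].

Definition spec_subbase d (A : temporalHeytingType d) : set (set (Spec A)) :=
  [set U | exists a : A, U = spec_pi a \/ U = ~` spec_pi a].

HB.instance Definition _ d (A : temporalHeytingType d) :=
  isSubBaseTopological.Build (Spec A) (@spec_subbase d A) id.

Section Spectrum.
Context d (A : temporalHeytingType d).
Implicit Types (x y z w : Spec A) (S : set (Spec A)).

Definition spec_le x y : Prop := pset x `<=` pset y.

Definition upset S : Prop := forall x y, S x -> spec_le x y -> S y.

Definition upcone x : set (Spec A) := [set y | spec_le x y].

Definition Rpast x w : Prop := forall a : A, pset w a -> pset x (past a).

Definition archival S : Prop :=
  forall x z, ~ S x -> S z -> Rpast z x ->
    ([set w | Rpast z w] `&` upcone x `&` S) !=set0.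

Definition topo_reachable x y : Prop :=
  forall S, closed S -> archival S -> upset S -> S x -> S y.

Definition topo_root x : Prop := forall y, topo_reachable x y.

End Spectrum.

(* Main.v *)
(* Past filters and closed archival upsets of the spectrum are in
   order-reversing bijection, through [F |-> {x | F `<=` x}] and [S |->
     {a | S `<=` spec_pi a}].
   Hence a second-least past filter is a largest proper closed archival upset,
   and the roots are exactly the points outside all proper closed archival
   upsets: if they form a nonempty open set, its complement is the largest one.
   On the algebraic side, past filters are the kernels of morphisms, and [A] is
   a subdirect product of its quotients by the nontrivial past filters as soon
   as these intersect trivially. *)
From HB Require Import structures.
Require Import Defs.
From mathcomp Require Import all_boot all_order finmap.
From mathcomp Require Import all_classical.
From mathcomp Require Import topology.

Set Implicit Arguments.
Unset Strict Implicit.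
Unset Printing Implicit Defensive.

Import Order.TTheory.
Local Open Scope classical_set_scope.

(** * Heyting implication and the temporal operators *)

Section HeytingTheory.
Local Open Scope order_scope.
Context d (A : heytingType d).
Implicit Types a b c : A.

Lemma himp_mp a b : himp a b `&` a <= b.
Proof. by rewrite -lehimp. Qed.

Lemma himp_top a b : (himp a b == \top) = (a <= b).
Proof. by rewrite -le1x lehimp meet1x. Qed.

Lemma himp_curry a b c : himp c (himp a b) = himp (c `&` a) b.
Proof.
apply/eqP; rewrite eq_le; apply/andP; split.
  by rewrite lehimp meetA -!lehimp.
by rewrite !lehimp -meetA himp_mp.
Qed.

Lemma himp_trans a b c : himp a b `&` himp b c <= himp a c.
Proof.
rewrite lehimp; apply: le_trans (himp_mp b c).
rewrite lexI; apply/andP; split; first by rewrite leIxl // leIr.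
by apply: le_trans (himp_mp a b); rewrite leI2 // leIl.
Qed.

Lemma himpIr a b c : himp a (b `&` c) = himp a b `&` himp a c.
Proof.
apply/eqP; rewrite eq_le lexI !lehimp -andbA; apply/and3P; split.
- by apply: le_trans (himp_mp _ _) _; rewrite leIl.
- by apply: le_trans (himp_mp _ _) _; rewrite leIr.
by rewrite lexI -(lehimp a b) -(lehimp a c) leIl leIr.
Qed.

Lemma himpUl a b c : himp (a `|` b) c = himp a c `&` himp b c.
Proof.
apply/eqP; rewrite eq_le lexI !lehimp -andbA; apply/and3P; split.
- by apply: le_trans (himp_mp (a `|` b) c); rewrite leI2 // leUl.
- by apply: le_trans (himp_mp (a `|` b) c); rewrite leI2 // leUr.
rewrite meetC -lehimp leUx !lehimp !(meetC _ (_ `&` _)).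
by rewrite -(lehimp a c) -(lehimp b c) leIl leIr.
Qed.

End HeytingTheory.

Section TemporalTheory.
Local Open Scope order_scope.
Context d (A : temporalHeytingType d).
Implicit Types a b c : A.

Lemma box_homo a b : a <= b -> box a <= box b.
Proof. by move=> /meet_idPl <-; rewrite boxI leIr. Qed.

Lemma past_homo a b : a <= b -> past a <= past b.
Proof. by move=> ab; rewrite past_le (le_trans ab) // -past_le. Qed.

Lemma pastU a b : past (a `|` b) = past a `|` past b.
Proof.
apply/eqP; rewrite eq_le leUx past_le leUx -!past_le leUl leUr /=.
by rewrite !past_homo ?leUl ?leUr.
Qed.

Lemma past0 : past (\bot : A) = \bot.
Proof. by apply/eqP; rewrite -lex0 past_le le0x. Qed.

(** Since [himp a b] lies below its own box and [box] preserves meets, modus ponens passes under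
    [box]. Hence every lattice filter is compatible with [box], and only [past] puts a condition on
    the filters that define congruences. *)
Lemma le_himp_box a b : himp a b <= himp (box a) (box b).
Proof.
rewrite lehimp (le_trans (leI2 (le_box _) (lexx (box a)))) // -boxI.
by rewrite box_homo // himp_mp.
Qed.

End TemporalTheory.

(** * Lattice filters and past filters *)

Section LatticeFilter.
Local Open Scope order_scope.
Context d (A : temporalHeytingType d) (F : set A).
Hypothesis filterF : lattice_filter F.
Implicit Types a b c : A.

Lemma filter_le a b : F a -> a <= b -> F b.
Proof. by case: filterF => _ + _; apply. Qed.

Lemma filter_top : F \top.
Proof. by case: filterF => [[a Fa] _ _]; apply: filter_le Fa (lex1 _). Qed.

Lemma filter_meet a b : F (a `&` b) <-> F a /\ F b.
Proof.
split=> [Fab|[]]; last by case: filterF => _ _; apply.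
by split; apply: filter_le Fab _; rewrite ?leIl ?leIr.
Qed.

Lemma filter_himp_le a b : a <= b -> F (himp a b).
Proof. by rewrite -himp_top => /eqP ->; exact: filter_top. Qed.

Lemma filter_himp_trans b a c : F (himp a b) -> F (himp b c) -> F (himp a c).
Proof.
by move=> Fab Fbc; apply: filter_le (himp_trans a b c); apply/filter_meet.
Qed.

Lemma filter_mp a b : F (himp a b) -> F a -> F b.
Proof. by move=> Fab Fa; apply: filter_le (himp_mp a b); apply/filter_meet. Qed.

Lemma filter_bot : F \bot -> F = setT.
Proof.
by move=> F0; apply/seteqP; split=> // a _; apply: filter_le F0 (le0x _).
Qed.

End LatticeFilter.

Section PastFilter.
Local Open Scope order_scope.
Context d (A : temporalHeytingType d).
Implicit Types (F : set A) (a b c : A).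

Lemma past_filter_top : past_filter [set \top : A].
Proof.
split; first split.
- by exists \top.
- by move=> a b /= ->; rewrite le1x => /eqP.
- by move=> a b /= -> ->; rewrite meetxx.
by move=> a b /= /eqP; rewrite himp_top => ab; apply/eqP;
  rewrite himp_top past_homo.
Qed.

Lemma is_least_past_filter (m : set A) :
  is_least [set G : set A | past_filter G] m <-> m = [set \top].
Proof.
split=> [[mF mle]|->]; last first.
  split=> [|F FF _ ->]; first exact: past_filter_top.
  by apply: filter_top; case: FF.
apply/seteqP; split; first by apply: mle; exact: past_filter_top.
by move=> _ ->; apply: filter_top; case: mF.
Qed.

Lemma past_filter_neq_top F :
  past_filter F -> F <> [set \top] -> exists2 a, F a & a != \top.
Proof.
move=> [FF _] Fn; apply: contrapT => no; apply: Fn; apply/seteqP; split.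
  by move=> a Fa /=; apply/eqP; apply: contra_notT no => an; exists a.
by move=> _ ->; exact: filter_top.
Qed.

Lemma second_least_past_filterP F :
  is_second_least [set G : set A | past_filter G] F <->
  [/\ past_filter F, F <> [set \top] &
      forall G, past_filter G -> G <> [set \top] -> F `<=` G].
Proof.
split=> [[m /is_least_past_filter ->] [[FF Fn] Fle]|[FF Fn Fle]].
  by split=> // G GF Gn; apply: Fle.
exists [set \top]; first exact/is_least_past_filter.
by split=> // G [GF Gn]; apply: Fle.
Qed.

(** The adjunction of [past] and [box] survives modulo [F]. One direction applies [box] and composes
    with the unit, [a] below [box (past a)]; the other applies [past], which is where [F] must be a
    past filter, and composes with the counit, [past (box b)] below [b]. *)
Lemma filter_himp_past F a b :
  past_filter F -> F (himp (past a) b) <-> F (himp a (box b)).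
Proof.
move=> [FF FP]; split=> [Fab|/FP Fab].
  apply: (filter_himp_trans FF (b := box (past a))).
    by apply: filter_himp_le => //; rewrite -past_le.
  exact: (filter_le FF Fab (le_himp_box _ _)).
apply: (filter_himp_trans FF Fab).
by apply: filter_himp_le => //; rewrite past_le.
Qed.

End PastFilter.

(** * The quotient of a temporal Heyting algebra by a past filter *)

Record pastFilter d (A : temporalHeytingType d) := PastFilter {
  pf_set : set A;
  pf_past : past_filter pf_set
}.

Section Quotient.
Local Open Scope order_scope.
Local Open Scope quotient_scope.
Context d (A : temporalHeytingType d) (F : pastFilter A).
Implicit Types a b c : A.

Let filterF : lattice_filter (pf_set F). Proof. by case: (pf_past F). Qed.

Definition pf_eq a b := `[< pf_set F (himp a b) /\ pf_set F (himp b a) >].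

Lemma pf_eq_refl : reflexive pf_eq.
Proof. by move=> a; apply/asboolP; split; exact: filter_himp_le. Qed.

Lemma pf_eq_sym : symmetric pf_eq.
Proof. by move=> a b; apply: asbool_equiv_eq; split=> -[]. Qed.

Lemma pf_eq_trans : transitive pf_eq.
Proof.
move=> b a c /asboolP[ab ba] /asboolP[bc cb]; apply/asboolP.
by split; apply: (filter_himp_trans filterF (b := b)).
Qed.

Canonical pf_equiv := EquivRel pf_eq pf_eq_refl pf_eq_sym pf_eq_trans.

(** The closure properties are bundled in [F], so the structures declared on [quot] depend on no
    further hypothesis. *)
Definition quot : Type := {eq_quot pf_eq}.
HB.instance Definition _ := Choice.on quot.
HB.instance Definition _ := EqQuotient.on quot.

Definition qpi a : quot := \pi_quot a.

Lemma qpi_surj (x : quot) : exists a, qpi a = x.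
Proof. by exists (repr x); rewrite /qpi reprK. Qed.

Lemma qpi_eq a b :
  qpi a = qpi b <-> pf_set F (himp a b) /\ pf_set F (himp b a).
Proof. by split=> [/eqquotP/asboolP|ab]; last exact/eqquotP/asboolP. Qed.

Definition qlift1 (op : A -> A) (x : quot) : quot := qpi (op (repr x)).
Definition qlift2 (op : A -> A -> A) (x y : quot) : quot :=
  qpi (op (repr x) (repr y)).
Definition qle (x y : quot) : bool := `[< pf_set F (himp (repr x) (repr y)) >].

Lemma repr_qpi a :
  pf_set F (himp (repr (qpi a)) a) /\ pf_set F (himp a (repr (qpi a))).
Proof. by apply/qpi_eq; rewrite /qpi reprK. Qed.

Lemma qle_pi a b : qle (qpi a) (qpi b) <-> pf_set F (himp a b).
Proof.
have [ra ar] := repr_qpi a; have [rb br] := repr_qpi b.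
split=> [/asboolP ab|ab].
  apply: (filter_himp_trans filterF ar).
  exact: (filter_himp_trans filterF ab).
apply/asboolP; apply: (filter_himp_trans filterF ra).
exact: (filter_himp_trans filterF ab).
Qed.

Lemma qlift1_pi op a :
  (forall a b, pf_set F (himp a b) -> pf_set F (himp (op a) (op b))) ->
  qlift1 op (qpi a) = qpi (op a).
Proof.
move=> opF; have [ra ar] := repr_qpi a.
by apply/qpi_eq; split; apply: opF.
Qed.

Lemma qle_refl : reflexive qle.
Proof. by move=> x; apply/asboolP; exact: filter_himp_le. Qed.

Lemma qle_anti : antisymmetric qle.
Proof.
move=> x y; have [a <-] := qpi_surj x; have [b <-] := qpi_surj y.
by move=> /andP[/qle_pi ab /qle_pi ba]; apply/qpi_eq.
Qed.

Lemma qle_trans : transitive qle.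
Proof.
move=> y x z /asboolP xy /asboolP yz; apply/asboolP.
exact: filter_himp_trans xy yz.
Qed.

(** The quotient keeps the display [d], as [subdirect_embedding] demands of the factors. *)
HB.instance Definition _ := Order.Le_isPOrder.Build d quot
  qle_refl qle_anti qle_trans.

Lemma le_qpi a b : (qpi a <= qpi b) <-> pf_set F (himp a b).
Proof. exact: qle_pi. Qed.

Lemma qlexI x y z :
  (x <= qlift2 Order.meet y z) = (x <= y) && (x <= z).
Proof.
have [a <-] := qpi_surj x.
(* By definition [qlift2] is already the class of a meet of representatives, so only the occurrences
   of [y] and [z] on the right have to be written as classes. *)
rewrite -{2}[y]reprK -{2}[z]reprK.
apply/idP/andP => [/le_qpi|[/le_qpi ab /le_qpi ac]].
  by rewrite himpIr => /(filter_meet filterF)[ab ac]; split; apply/le_qpi.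
by apply/le_qpi; rewrite himpIr; apply/(filter_meet filterF).
Qed.

Lemma qleUx x y z :
  (qlift2 Order.join x y <= z) = (x <= z) && (y <= z).
Proof.
have [a <-] := qpi_surj z.
rewrite -{2}[x]reprK -{2}[y]reprK.
apply/idP/andP => [/le_qpi|[/le_qpi ab /le_qpi ac]].
  by rewrite himpUl => /(filter_meet filterF)[ab ac]; split; apply/le_qpi.
by apply/le_qpi; rewrite himpUl; apply/(filter_meet filterF).
Qed.

HB.instance Definition _ :=
  Order.POrder_isMeetSemilattice.Build d quot qlexI.
HB.instance Definition _ :=
  Order.POrder_isJoinSemilattice.Build d quot qleUx.

Lemma qle0x (x : quot) : qpi \bot <= x.
Proof.
by have [a <-] := qpi_surj x; apply/le_qpi; apply: (filter_himp_le filterF);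
  rewrite ?le0x ?lex1.
Qed.

Lemma qlex1 (x : quot) : x <= qpi \top.
Proof.
by have [a <-] := qpi_surj x; apply/le_qpi; apply: (filter_himp_le filterF);
  rewrite ?le0x ?lex1.
Qed.

HB.instance Definition _ := Order.hasBottom.Build d quot qle0x.
HB.instance Definition _ := Order.hasTop.Build d quot qlex1.

Lemma qpiI : {morph qpi : a b / a `&` b}.
Proof.
move=> a b; apply/eqP; rewrite eq_le lexI.
have [ra _] := repr_qpi a; have [rb _] := repr_qpi b.
apply/andP; split; first by apply/andP; split; apply/le_qpi;
  apply: (filter_himp_le filterF); rewrite ?leIl ?leIr.
apply/le_qpi; rewrite himpIr; apply/(filter_meet filterF); split.
  by apply: (filter_himp_trans filterF _ ra); apply: filter_himp_le;
    rewrite ?leIl.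
by apply: (filter_himp_trans filterF _ rb); apply: filter_himp_le;
  rewrite ?leIr.
Qed.

Lemma qpiU : {morph qpi : a b / a `|` b}.
Proof.
move=> a b; apply/eqP; rewrite eq_le leUx.
have [_ ar] := repr_qpi a; have [_ br] := repr_qpi b.
apply/andP; split; last by apply/andP; split; apply/le_qpi;
  apply: (filter_himp_le filterF); rewrite ?leUl ?leUr.
apply/le_qpi; rewrite himpUl; apply/(filter_meet filterF); split.
  by apply: (filter_himp_trans filterF ar); apply: filter_himp_le;
    rewrite ?leUl.
by apply: (filter_himp_trans filterF br); apply: filter_himp_le; rewrite ?leUr.
Qed.

Lemma qlehimp (x y z : quot) : (z <= qlift2 himp x y) = (z `&` x <= y).
Proof.
have [c <-] := qpi_surj z.
have -> : (qpi c `&` x <= y) = (qpi (c `&` repr x) <= qpi (repr y)).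
  by rewrite qpiI /qpi !reprK.
apply/idP/idP => /le_qpi; first by rewrite himp_curry => ?; apply/le_qpi.
by rewrite -himp_curry => ?; apply/le_qpi.
Qed.

HB.instance Definition _ := TBLattice_isHeyting.Build d quot qlehimp.

Lemma qpi_imp : {morph qpi : a b / himp a b}.
Proof.
move=> a b; apply/eqP; rewrite eq_le lehimp -qpiI; apply/andP; split.
  by apply/le_qpi; apply: (filter_himp_le filterF); exact: himp_mp.
(* A representative [c] of the implication in the quotient turns the remaining inequality into
   residuation in [A], modulo [F]. *)
have [c cE] := qpi_surj (himp (qpi a) (qpi b)).
have : qpi c <= himp (qpi a) (qpi b) by rewrite cE.
by rewrite lehimp -qpiI -cE => /le_qpi; rewrite -himp_curry => /le_qpi.
Qed.

Lemma pf_box a b :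
  pf_set F (himp a b) -> pf_set F (himp (box a) (box b)).
Proof. by move=> Fab; apply: (filter_le filterF Fab (le_himp_box a b)). Qed.

Lemma pf_past_homo a b :
  pf_set F (himp a b) -> pf_set F (himp (past a) (past b)).
Proof. by case: (pf_past F) => _; apply. Qed.

Lemma qbox_pi a : qlift1 box (qpi a) = qpi (box a).
Proof. exact: qlift1_pi pf_box. Qed.

Lemma qpast_pi a : qlift1 past (qpi a) = qpi (past a).
Proof. exact: qlift1_pi pf_past_homo. Qed.

Lemma qboxI x y : qlift1 box (x `&` y) = qlift1 box x `&` qlift1 box y.
Proof.
have [a <-] := qpi_surj x; have [b <-] := qpi_surj y.
by rewrite -qpiI !qbox_pi boxI qpiI.
Qed.

Lemma le_qbox x : x <= qlift1 box x.
Proof.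
have [a <-] := qpi_surj x; rewrite qbox_pi.
by apply/le_qpi; apply: (filter_himp_le filterF); exact: le_box.
Qed.

Lemma qbox_le x y : qlift1 box x <= y `|` himp y x.
Proof.
have [a <-] := qpi_surj x; have [b <-] := qpi_surj y.
rewrite qbox_pi -qpi_imp -qpiU.
by apply/le_qpi; apply: (filter_himp_le filterF); exact: box_le.
Qed.

Lemma qpast_le x y : (qlift1 past x <= y) = (x <= qlift1 box y).
Proof.
have [a <-] := qpi_surj x; have [b <-] := qpi_surj y.
rewrite qbox_pi qpast_pi.
by apply/idP/idP => /le_qpi /(filter_himp_past _ _ (pf_past F)) /le_qpi.
Qed.

HB.instance Definition _ := Heyting_isTemporal.Build d quot
  qboxI le_qbox qbox_le qpast_le.

Lemma qpi_morphism : temporal_morphism qpi.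
Proof.
split=> //.
- exact: qpiI.
- exact: qpiU.
- exact: qpi_imp.
- by move=> a; rewrite -qbox_pi.
- by move=> a; rewrite -qpast_pi.
Qed.

End Quotient.

(** * Subdirect irreducibility and the second-least past filter *)

Section SubdirectlyIrreducible.
Local Open Scope order_scope.
Context d (A : temporalHeytingType d).

Lemma tmorph_homo (B : temporalHeytingType d) (f : A -> B) :
  temporal_morphism f -> {homo f : a b / a <= b}.
Proof. by move=> mf a b /meet_idPl <-; rewrite (tmorphI mf) leIr. Qed.

Lemma kernel_past_filter (B : temporalHeytingType d) (f : A -> B) :
  temporal_morphism f -> past_filter [set a | f a = \top].
Proof.
move=> mf; split; first split.
- by exists \top; exact: tmorph1 mf.
- by move=> a b /= fa /(tmorph_homo mf); rewrite fa le1x => /eqP.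
- by move=> a b /= fa fb; rewrite (tmorphI mf) fa fb meetxx.
move=> a b /= /eqP; rewrite (tmorph_imp mf) himp_top => fab; apply/eqP.
by rewrite (tmorph_imp mf) himp_top !(tmorph_past mf) past_homo.
Qed.

(** If [u] and [v] have equal images, [himp u v] is sent to the top, hence is the top, so [u] lies
    below [v]; the situation is symmetric. *)
Lemma kernel_top_inj (B : temporalHeytingType d) (f : A -> B) :
  temporal_morphism f -> [set a | f a = \top] = [set \top] -> injective f.
Proof.
move=> mf kf a b fab.
have le_ab (u v : A) : f u = f v -> u <= v.
  move=> fuv; rewrite -himp_top; apply/eqP.
  have : [set a | f a = \top] (himp u v).
    by apply/eqP; rewrite (tmorph_imp mf) himp_top fuv.
  by rewrite kf.
by apply/eqP; rewrite eq_le !le_ab.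
Qed.

Lemma past_filter_bigcap (C : set (set A)) :
  (forall F, C F -> past_filter F) -> past_filter (\bigcap_(F in C) F).
Proof.
move=> CF; split; first split.
- by exists \top => F /CF[FF _]; exact: filter_top.
- by move=> a b Fa ab F CF'; have [FF _] := CF _ CF';
    apply: filter_le (Fa _ CF') ab.
- move=> a b Fa Fb F CF'; have [FF _] := CF _ CF'.
  by apply/(filter_meet FF); split; [apply: Fa|apply: Fb].
by move=> a b Fab F CF'; have [_ FP] := CF _ CF'; apply: FP; apply: Fab.
Qed.

(** The candidate is the intersection of all nontrivial past filters. Were it trivial, the quotient
    maps would form a subdirect embedding and one of them would be bijective, although each
    collapses a nontrivial filter. For the one-element algebra the family is empty and the same
    argument yields an index in an empty type. *)
Lemma subdirectly_irreducible_second_least :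
  subdirectly_irreducible A ->
  exists F : set A, is_second_least [set G : set A | past_filter G] F.
Proof.
move=> siA.
pose C := [set G : set A | past_filter G /\ G <> [set \top]].
exists (\bigcap_(F in C) F); apply/second_least_past_filterP; split.
- by apply: past_filter_bigcap => F [].
- move=> trivC.
  pose I := {F : pastFilter A | pf_set F <> [set \top]}.
  pose f (a : A) (i : I) : quot (sval i) := qpi (sval i) a.
  have emb_f : subdirect_embedding (B := fun i : I => quot (sval i)) f.
    split=> [a b fab|i]; last by split; [exact: qpi_morphism|exact: qpi_surj].
    have CF (u v : A) : f u = f v -> u <= v.
      move=> fuv; rewrite -himp_top; apply/eqP.
      have : (\bigcap_(F in C) F) (himp u v).
        move=> F [FF Fn]; pose i : I := exist _ (PastFilter FF) Fn.
        have : f u i = f v i by rewrite fuv.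
        by move/qpi_eq => [].
      by rewrite trivC.
    by apply/eqP; rewrite eq_le !CF.
  have [[F Fn] [g fK _]] := siA _ _ _ emb_f.
  (* An element [a] of [F] other than the top has the same class as the top. *)
  have [a Fa /eqP[]] := past_filter_neq_top (pf_past F) Fn.
  apply: (can_inj fK); apply/qpi_eq => /=; have [FF _] := pf_past F.
  split; first by apply: filter_himp_le => //; exact: lex1.
  by apply: (filter_le FF Fa); rewrite lehimp leIl.
by move=> G GF Gn a; apply.
Qed.

(** If every component had a nontrivial kernel, all kernels would contain [F], so an element of [F]
    other than the top would have the same image as the top under [f]. Hence some component has a
    trivial kernel, so it is injective, and it is surjective by assumption. *)
Lemma second_least_subdirectly_irreducible :
  (exists F : set A, is_second_least [set G : set A | past_filter G] F) ->
  subdirectly_irreducible A.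
Proof.
move=> [F /second_least_past_filterP[FF Fn Fle]] I B f [injf mf].
have [a Fa /eqP an] := past_filter_neq_top FF Fn.
have [i ker_i] : exists i, [set a | f a i = \top] = [set \top].
  apply: contrapT => no; apply: an; apply: injf;
    apply: functional_extensionality_dep => i.
  have [mi _] := mf i; rewrite (tmorph1 mi).
  apply: (Fle [set a | f a i = \top]) => //; first exact: kernel_past_filter mi.
  by move=> ker_i; apply: no; exists i.
exists i; have [mi surj_i] := mf i.
have [g gK] := choice surj_i.
by exists g => // b; apply: (kernel_top_inj mi ker_i).
Qed.

End SubdirectlyIrreducible.

(** * The prime filter theorem *)

Section PrimeFilters.
Local Open Scope order_scope.
Context d (A : temporalHeytingType d).
Implicit Types (F G : set A) (a b c : A).

(* Adjoining [a] to the filter [F] gives [fun c => F (himp a c)]. *)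
Lemma filter_adjoin F a : lattice_filter F ->
  lattice_filter [set c | F (himp a c)].
Proof.
move=> FF; split.
- by exists a; apply: filter_himp_le.
- by move=> b c /= Fab bc; apply: (filter_himp_trans FF Fab);
    apply: filter_himp_le.
- by move=> b c /= Fab Fac; rewrite himpIr; apply/(filter_meet FF).
Qed.

(** Zorn's lemma gives a filter that is maximal among those containing [G] and disjoint from the
    ideal [J]. It is prime: if it contained [a] joined with [b] but neither of them, adjoining
    either one would reach [J], and the join of the two elements reached would lie both in the
    filter and in [J]. *)
Lemma prime_filter_separation G (J : set A) :
  lattice_filter G -> J \bot -> (forall a b, a <= b -> J b -> J a) ->
  (forall a b, J a -> J b -> J (a `|` b)) -> (forall a, G a -> ~ J a) ->
  exists w : Spec A, G `<=` pset w /\ forall a, pset w a -> ~ J a.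
Proof.
move=> GF J0 Jle JU GJ.
(* Union with [G] makes the empty chain harmless. *)
pose P (X : set A) := lattice_filter (X `|` G)%classic /\
  forall a, (X `|` G)%classic a -> ~ J a.
have [C CP Ctot|X [[XF XJ] Xmax]] := @Zorn_bigcup A P.
  split; last first.
    by move=> a [[X CX Xa]|/GJ//]; have [_ ] := CP _ CX; apply; left.
  split.
  - by exists \top; right; exact: filter_top.
  - move=> a b [[X CX Xa]|Ga] ab; last by right; apply: filter_le Ga ab.
    have [XF _] := CP _ CX.
    have [Xb|Gb] : (X `|` G)%classic b by apply: (filter_le XF _ ab); left.
      by left; exists X.
    by right.
  have CG X a b : C X -> (X `|` G)%classic a -> (X `|` G)%classic b ->
      ((\bigcup_(X in C) X) `|` G)%classic (a `&` b).
    move=> CX Xa Xb; have [XF _] := CP _ CX.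
    have [Xab|Gab] : (X `|` G)%classic (a `&` b) by apply/(filter_meet XF).
      by left; exists X.
    by right.
  move=> a b [[X CX Xa]|Ga] [[Y CY Yb]|Gb].
  - have [XY|YX] := Ctot _ _ CX CY.
      by apply: (CG Y) => //; left => //; apply: XY.
    by apply: (CG X) => //; left => //; apply: YX.
  - by apply: (CG X) => //; [left|right].
  - by apply: (CG Y) => //; [right|left].
  - by right; apply/(filter_meet GF).
set W := (X `|` G)%classic in XF XJ.
(* By maximality, the filter generated by [W] and a new element [a] must meet [J]. *)
have adjoinJ a : ~ W a -> exists2 c, J c & W (himp a c).
  move=> nWa; apply: contrapT => no.
  have WY : W `<=` [set c | W (himp a c)].
    by move=> c Wc /=; apply: (filter_le XF Wc); rewrite lehimp leIl.
  have GY : ([set c | W (himp a c)] `|` G)%classic = [set c | W (himp a c)].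
    by apply/setUidPl => c Gc; apply: WY; right.
  apply: (Xmax [set c | W (himp a c)]).
    split; first by move=> c Xc; apply: WY; left.
    move=> /(_ a) XW; apply: nWa; left; apply: XW.
    by apply: filter_himp_le.
  rewrite /P GY; split; first exact: filter_adjoin.
  by move=> c Wac Jc; apply: no; exists c.
have Wprime : prime_filter W.
  split=> //.
    by move=> WT; apply: (XJ \bot) => //; rewrite WT.
  move=> a b Wab; have [Wa|/adjoinJ[c1 Jc1 W1]] := pselect (W a); first by left.
  have [Wb|/adjoinJ[c2 Jc2 W2]] := pselect (W b); first by right.
  exfalso; apply: (XJ (c1 `|` c2)); last exact: JU.
  apply: (filter_mp XF _ Wab); rewrite himpUl; apply/(filter_meet XF); split.
    by apply: (filter_himp_trans XF W1); apply: filter_himp_le => //;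
      rewrite leUl.
  by apply: (filter_himp_trans XF W2); apply: filter_himp_le => //;
    rewrite leUr.
have memW : W \in [set x : set A | prime_filter x] by rewrite inE.
exists (exist _ W memW : Spec A); split=> //.
by move=> a Ga; right.
Qed.

End PrimeFilters.

(** * Points and basic open sets of the spectrum *)

Section Duality.
Local Open Scope order_scope.
Context d (A : temporalHeytingType d).
Implicit Types (F : set A) (S : set (Spec A)) (a b c : A) (x y z w : Spec A).

Lemma pset_prime x : prime_filter (pset x).
Proof. by case: x => X XP; exact: set_mem XP. Qed.

Lemma pset_filter x : lattice_filter (pset x).
Proof. by case: (pset_prime x). Qed.

Lemma pset_bot x : ~ pset x \bot.
Proof. by move=> /(filter_bot (pset_filter x)); case: (pset_prime x). Qed.

Lemma pset_join x a b : pset x (a `|` b) -> pset x a \/ pset x b.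
Proof. by case: (pset_prime x) => _ _; apply. Qed.

Lemma prime_avoiding F a :
  lattice_filter F -> ~ F a -> exists w, F `<=` pset w /\ ~ pset w a.
Proof.
move=> FF nFa.
have [||||w [Fw wa]] := @prime_filter_separation _ A F [set b | b <= a] FF.
- exact: le0x.
- by move=> b c bc /= ca; apply: le_trans ca.
- by move=> b c /= ba ca; rewrite leUx ba ca.
- by move=> b Fb /= ba; apply: nFa; apply: filter_le ba.
by exists w; split=> // /wa; apply; exact: lexx.
Qed.

(** Adjoining [a] to [x] gives a filter that omits [b]; a prime filter above it that still omits [b]
    is the required [y]. *)
Lemma prime_not_himp x a b :
  ~ pset x (himp a b) -> exists y, [/\ spec_le x y, pset y a & ~ pset y b].
Proof.
move=> nxab; have xF := pset_filter x.
have [y [xy nyb]] := prime_avoiding (filter_adjoin a xF) nxab.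
exists y; split=> //.
  by move=> c xc; apply: xy; apply: (filter_le xF xc); rewrite lehimp leIl.
by apply: xy => /=; apply: filter_himp_le.
Qed.

(* [past] preserves finite joins, hence [~ pset z (past a)] defines an ideal. *)
Lemma Rpast_extension F z : lattice_filter F ->
  (forall a, F a -> pset z (past a)) -> exists w, F `<=` pset w /\ Rpast z w.
Proof.
move=> FF Fz; have zF := pset_filter z.
have [||||w [Fw wz]] := @prime_filter_separation _ A F [set a | ~ pset z (past a)] FF.
- by rewrite /= past0; exact: pset_bot.
- by move=> a b ab /= nb za; apply: nb; apply: (filter_le zF za);
    exact: past_homo.
- by move=> a b /= na nb; rewrite pastU => /pset_join[].
- by move=> a /Fz za; apply.
by exists w; split=> // a /wz /contrapT.
Qed.

Lemma open_spec_piC a : open (~` spec_pi a : set (Spec A))%classic.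
Proof.
exists [set (~` spec_pi a)%classic]; last by rewrite bigcup_set1.
move=> _ ->; exists [fset (~` spec_pi a : set (Spec A))%classic]%fset.
  by move=> U /fset1P ->; rewrite inE; exists a; right.
by rewrite set_fset1 bigcap_set1.
Qed.

(** A finite intersection of subbasic sets is a single difference of two sets [spec_pi]: the
    positive conditions are merged by a meet, and the negative ones by a join because the points are
    prime. *)
Lemma spec_open_basic (U : set (Spec A)) y : open U -> U y ->
  exists a b, [/\ pset y a, ~ pset y b &
    forall x, pset x a -> ~ pset x b -> U x].
Proof.
move=> oU; have [C Cfin <-] : exists2 C : set (set (Spec A)),
  C `<=` finI_from (@spec_subbase _ A) id & \bigcup_(V in C) V = U := oU.
move=> [V CV Vy].
have [E Esub EV] := Cfin _ CV.
have Ey W : W \in (E : seq _) -> W y by move=> WE; move: Vy; rewrite -EV; apply.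
have {Ey} : exists a b, [/\ pset y a, ~ pset y b &
    forall x, pset x a -> ~ pset x b -> forall W, W \in (E : seq _) -> W x].
  have {Esub} : {subset (E : seq _) <= @spec_subbase _ A} by [].
  elim: (E : seq _) Ey => [|W s IH] sy ssub.
    by exists \top, \bot; split=> //; [apply: filter_top;
      exact: pset_filter|exact: pset_bot].
  have [||a [b [ya nyb sab]]] := IH.
  - by move=> W' W's; apply: sy; rewrite inE W's orbT.
  - by move=> W' W's; apply: ssub; rewrite inE W's orbT.
  have : W \in @spec_subbase _ A by apply: ssub; rewrite inE eqxx.
  have Wy : W y by apply: sy; rewrite inE eqxx.
  rewrite inE => -[c [] WE]; rewrite WE in Wy *.
    exists (a `&` c), b; split=> //; first exact/(filter_meet (pset_filter y)).
    move=> x /(filter_meet (pset_filter x))[xa xc] nxb W'.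
    by rewrite inE => /orP[/eqP ->//|]; apply: sab.
  exists a, (b `|` c); split=> //; first by move/pset_join => [].
  move=> x xa nxbc W'.
  have xle e : e <= b `|` c -> ~ pset x e.
    by move=> le_e xe; apply: nxbc; apply: filter_le le_e => //;
      exact: pset_filter.
  rewrite inE => /orP[/eqP ->|].
    by apply: xle; rewrite leUr.
  by apply: sab => //; apply: xle; rewrite leUl.
move=> [a [b [ya nyb ab]]]; exists a, b; split=> // x xa nxb.
by exists V => //; rewrite -EV => W; apply: ab.
Qed.

(** * Past filters and closed archival upsets *)

Definition spec_above F : set (Spec A) := [set x | F `<=` pset x].

Definition spec_meet S : set A := [set a | S `<=` spec_pi a].

Lemma spec_above_closed F : closed (spec_above F).
Proof.
have -> : spec_above F = \bigcap_(a in F) spec_pi a.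
  by apply/seteqP; split=> x xF a Fa; apply: xF.
by apply: closed_bigI => a _; rewrite -openC; exact: open_spec_piC.
Qed.

Lemma spec_above_upset F : upset (spec_above F).
Proof. by move=> x y Fx xy a /Fx /xy. Qed.

(** The point sought extends both [x] and [F] and is a past successor of [z]. The filter [G]
    generated by [x] and [F] extends to such a point: if [a] is in [x] and [himp a b] in [F], then
    [z] contains [past a] as well as [himp (past a) (past b)], hence [past b]. *)
Lemma spec_above_archival F : past_filter F -> archival (spec_above F).
Proof.
move=> [FF FP] x z _ Fz zx; have xF := pset_filter x.
pose G : set A := [set b | exists2 a, pset x a & F (himp a b)].
have GF : lattice_filter G.
  split.
  - by exists \top, \top; [exact: filter_top|exact: filter_himp_le].
  - move=> b c [a xa Fab] bc; exists a => //.
    by apply: (filter_himp_trans FF Fab); apply: filter_himp_le.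
  move=> b c [a1 xa1 F1] [a2 xa2 F2]; exists (a1 `&` a2).
    exact/(filter_meet xF).
  rewrite himpIr; apply/(filter_meet FF); split.
    by apply: (filter_himp_trans FF _ F1); apply: filter_himp_le => //;
      rewrite leIl.
  by apply: (filter_himp_trans FF _ F2); apply: filter_himp_le => //;
    rewrite leIr.
have [|w [Gw zw]] := @Rpast_extension G z GF.
  move=> b [a xa /FP /Fz Fab]; apply: (filter_mp (pset_filter z) Fab);
    exact: zx.
exists w; split; first split=> //.
  by move=> a xa; apply: Gw; exists a => //; apply: filter_himp_le.
move=> a Fa; apply: Gw; exists \top; first exact: filter_top.
by apply: (filter_le FF Fa); rewrite lehimp leIl.
Qed.

(** If the condition fails, some [z] in [S] contains [past a] but not [past b], so no past successor
    of [z] within [S] contains [a]. Yet the principal filter of [a] extends to a past successor [x]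
    of [z], and archivality replaces [x] by a larger past successor inside [S], which still contains
    [a]. *)
Lemma spec_meet_past_filter S : archival S -> upset S ->
  past_filter (spec_meet S).
Proof.
move=> Sarch Sup; split; first split.
- by exists \top => x _; apply: filter_top; exact: pset_filter.
- by move=> a b Sa ab x /Sa xa; apply: filter_le xa ab; exact: pset_filter.
- by move=> a b Sa Sb x Sx; apply/(filter_meet (pset_filter x)); split;
    [exact: Sa|exact: Sb].
move=> a b Sab z0 Sz0; apply: contrapT => /prime_not_himp[z [z0z za nzb]].
have Sz : S z by apply: Sup z0z.
have nSw w : S w -> Rpast z w -> ~ pset w a.
  move=> Sw zw wa; apply: nzb; apply: zw.
  by apply: filter_mp wa; [exact: pset_filter|exact: Sab].
have upF : lattice_filter [set c | a <= c].
  split; first by exists a; exact: lexx.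
    by move=> c e /= ac; apply: le_trans.
  by move=> c e /= ac ae; rewrite lexI ac ae.
have [|x [ax zx]] := @Rpast_extension [set c | a <= c] z upF.
  by move=> c /= ac; apply: (filter_le (pset_filter z) za); exact: past_homo.
have xa : pset x a by apply: ax; exact: lexx.
have [Sx|nSx] := pselect (S x); first exact: nSw xa.
have [w [[zw xw] Sw]] := Sarch _ _ nSx Sz zx.
by apply: (nSw w) => //; exact: xw.
Qed.

(* Heyting implication replaces compactness: if [spec_pi a `\` spec_pi b] is a
   neighbourhood of [y] avoiding the upset [S], then [himp a b] is in
   [spec_meet S]. *)
Lemma spec_meetK S : closed S -> upset S -> spec_above (spec_meet S) = S.
Proof.
move=> Scl Sup; apply/seteqP; split=> [y Sy|x Sx a]; last exact.
apply: contrapT => nSy; move: Scl; rewrite -openC => /spec_open_basic /(_ nSy).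
move=> [a [b [ya nyb ab]]]; apply: nyb.
apply: (filter_mp (pset_filter y)) ya; apply: Sy => x Sx.
apply: contrapT => /prime_not_himp[x' [xx' x'a /(ab _ x'a)]]; apply.
exact: Sup xx'.
Qed.

Lemma spec_aboveK F : lattice_filter F -> spec_meet (spec_above F) = F.
Proof.
move=> FF; apply/seteqP; split=> [a Fa|a Fa x]; last exact.
by apply: contrapT => /(prime_avoiding FF)[w [Fw]]; apply; exact: Fa.
Qed.

Lemma spec_above_top : spec_above [set \top] = setT.
Proof.
by apply/seteqP; split=> // x _ _ ->; apply: filter_top; exact: pset_filter.
Qed.

Lemma spec_above_setT F : lattice_filter F -> spec_above F = setT ->
  F = [set \top].
Proof.
move=> FF FT; rewrite -(spec_aboveK FF) FT -spec_above_top spec_aboveK //.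
by case: (past_filter_top A).
Qed.

(** * Topo-roots *)

Lemma topo_rootP x : topo_root x <->
  forall S, closed S -> archival S -> upset S -> S x -> S = setT.
Proof.
split=> [rx S Scl Sarch Sup Sx|rx y S Scl Sarch Sup Sx].
  by apply/seteqP; split=> // y _; exact: rx.
by rewrite (rx S).
Qed.

(** The roots are the complement of [spec_above F]. A closed archival upset through a point outside
    [spec_above F] has a past filter that does not contain [F]; this filter is then trivial and the
    upset is the whole space. As [F] is nontrivial, such points exist. *)
Lemma second_least_topo_roots :
  (exists F : set A, is_second_least [set G : set A | past_filter G] F) ->
  [set x : Spec A | topo_root x] !=set0 /\ open [set x : Spec A | topo_root x].
Proof.
move=> [F /second_least_past_filterP[FF Fn Fle]].
have FL : lattice_filter F by case: FF.
have rootsE : [set x | topo_root x] = (~` spec_above F)%classic.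
  apply/seteqP; split=> [x /topo_rootP rx Fx|x nFx].
    apply: Fn; apply: (spec_above_setT FL); apply: rx Fx.
    - exact: spec_above_closed.
    - exact: spec_above_archival.
    - exact: spec_above_upset.
  apply/topo_rootP => S Scl Sarch Sup Sx.
  have [ST|Sn] := pselect (spec_meet S = [set \top]).
    by rewrite -(spec_meetK Scl Sup) ST spec_above_top.
  have FS := Fle _ (spec_meet_past_filter Sarch Sup) Sn.
  by case: nFx => a /FS; apply.
rewrite rootsE; split; last by rewrite openC; exact: spec_above_closed.
apply: contrapT => no; apply: Fn; apply: (spec_above_setT FL).
by apply/seteqP; split=> // x _; apply: contrapT => nFx; apply: no; exists x.
Qed.

(** The set of non-roots is closed because the roots are open, and it inherits the other two
    properties from its description as a union: the points they require are found within a single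
    member. The given root makes it proper, so its filter is nontrivial. *)
Lemma topo_roots_second_least :
  [set x : Spec A | topo_root x] !=set0 /\ open [set x : Spec A | topo_root x] ->
  exists F : set A, is_second_least [set G : set A | past_filter G] F.
Proof.
move=> [[r rootr] openR].
(* The non-roots form the union of all proper closed archival upsets. *)
pose N : set (Spec A) := (~` [set x | topo_root x])%classic.
have Ncl : closed N by rewrite -openC setCK.
have NP x : N x -> exists S, [/\ closed S, archival S, upset S, S x & S `<=` N].
  move=> Nx; apply: contrapT => no; apply: Nx; apply/topo_rootP.
  move=> S Scl Sarch Sup Sx; apply: contrapT => Sn; apply: no.
  by exists S; split=> // y Sy /topo_rootP ry; apply: Sn; apply: ry.
have Nup : upset N.
  by move=> x y /NP[S [_ _ Sup Sx SN]] xy; apply: SN; apply: Sup xy.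
have Narch : archival N.
  move=> x z nNx /NP[S [_ Sarch _ Sz SN]] zx.
  have [w [zxw Sw]] := Sarch x z (fun Sx => nNx (SN _ Sx)) Sz zx.
  by exists w; split=> //; exact: SN.
exists (spec_meet N); apply/second_least_past_filterP; split.
- exact: spec_meet_past_filter.
- move=> NT; have : N r by rewrite -(spec_meetK Ncl Nup) NT spec_above_top.
  by apply.
move=> G GF Gn; have GL : lattice_filter G by case: GF.
(* As [spec_above G] is a proper closed archival upset, it contains no root; this inclusion in [N]
   is reversed on passing to filters. *)
rewrite -(spec_aboveK GL) => a Na x Gx; apply: Na => /topo_rootP rx.
apply: Gn; apply: (spec_above_setT GL); apply: rx Gx.
- exact: spec_above_closed.
- exact: spec_above_archival.
- exact: spec_above_upset.
Qed.

End Duality.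

Theorem theorem5p3 (d : Order.disp_t) (A : temporalHeytingType d) :
  (subdirectly_irreducible A <->
     exists F : set A, is_second_least [set G : set A | past_filter G] F) /\
  ((exists F : set A, is_second_least [set G : set A | past_filter G] F) <->
     [set x : Spec A | topo_root x] !=set0 /\
     open [set x : Spec A | topo_root x]).
Proof.
split; split.
- exact: subdirectly_irreducible_second_least.
- exact: second_least_subdirectly_irreducible.
- exact: second_least_topo_roots.
- exact: topo_roots_second_least.
Qed.
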